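(* For every finite simple graph $G$ of maximum degree $\Delta\ge 2$, $$\chi_o(G)\le \Delta+\left\lceil 4(\ln\Delta+\ln\ln\Delta+3)\right\rceil .$$
   Context: All graphs are finite, undirected and simple. An odd colouring of a graph $G$ is a proper vertex-colouring $\sigma$ of $G$ such that for every non-isolated vertex $v$ there is a colour that appears an odd number of times on the (open) neighbourhood $N_G(v)$. The odd chromatic number $\chi_o(G)$ is the minimum integer $k$ such that $G$ has an odd colouring $\sigma\colon V(G)\to\{1,\dots,k\}$. *)

(* Defs.v *)
From HB Require Import structures.
From mathcomp Require Import all_boot.
Set Implicit Arguments. Unset Strict Implicit. Unset Printing Implicit Defensive.

Record sgraph := SGraph {
  vertex :> finType;
  edge : rel vertex;
  edge_sym : symmetric edge;
  edge_irrefl : irreflexive edge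
}.

Section OddColouring.
Variable G : sgraph.

Definition neighbours (v : G) : {set G} := [set w | edge v w].

Definition max_degree : nat := \max_(v : G) #|neighbours v|.

Definition proper_colouring (k : nat) (s : {ffun G -> 'I_k}) : bool :=
  [forall v, forall w, edge v w ==> (s v != s w)].

Definition odd_colouring (k : nat) (s : {ffun G -> 'I_k}) : bool :=
  proper_colouring s &&
  [forall v, (neighbours v != set0) ==>
    [exists c, odd #|[set w in neighbours v | s w == c]|]].

Definition odd_colourable (k : nat) : bool :=
  [exists s : {ffun G -> 'I_k}, odd_colouring s].

Lemma odd_colourable_ex : exists k, odd_colourable k.
Proof.
exists #|G|; apply/existsP; exists [ffun v => enum_rank v].
apply/andP; split.
  apply/forallP => v; apply/forallP => w; apply/implyP => vw.
  rewrite !ffunE (inj_eq enum_rank_inj).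
  by apply: contraTneq vw => ->; rewrite edge_irrefl.
apply/forallP => v; apply/implyP => /set0Pn[w vw].
apply/existsP; exists (enum_rank w).
suff -> : [set u in neighbours v |
    [ffun x => enum_rank x] u == enum_rank w] = [set w] by rewrite cards1.
apply/setP => u; rewrite !inE ffunE (inj_eq enum_rank_inj).
by case: eqVneq => [->|_]; rewrite ?andbF // andbT; rewrite inE in vw.
Qed.

Definition odd_chromatic_number : nat := ex_minn odd_colourable_ex.

End OddColouring.

(* Main.v *)
Require Import Defs.
From mathcomp Require Import all_boot all_order all_algebra.
From mathcomp Require Import reals.
From mathcomp.analysis Require Import sequences exp.
From mathcomp Require Import ring lra zify.
Set Implicit Arguments. Unset Strict Implicit. Unset Printing Implicit Defensive.
Import Order.TTheory GRing.Theory Num.Theory.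
Local Open Scope ring_scope.

(** Call a colour odd on a vertex set if it appears there an odd number of times.
    A colouring is odd exactly when every edge, as a set of two vertices, and
    every nonempty neighbourhood has an odd colour. If all colours on such a
    hyperedge but one are fixed, at most one value of the last colour leaves no
    odd colour. A vertex in fewer hyperedges than there are colours can therefore
    always be coloured greedily, and the difficulty is that a vertex of degree
    [Delta] may lie in [2 * Delta] hyperedges.

    Let there be [Delta + t] colours and put [h] close to [t / 4]. Vertices of
    degree less than [h.*2] are low, the others are high. The low vertices are
    coloured last: each is in at most [4 * h - 2] hyperedges, which is less than
    the number of colours, and this takes care of all hyperedges that contain a
    low vertex ([greedy_odd_recolouring]).

    Among the high vertices, edges and the neighbourhoods of low vertices give at
    most one hyperedge per neighbour. Hence in a uniformly random colouring of
    the high vertices that has an odd colour on all of these, every vertex has at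
    least [t] colours to choose from, given the other vertices. There remain the
    neighbourhoods of high vertices that consist of high vertices. Redrawing
    [h.*2] vertices of such a neighbourhood one by one shows that it has no odd
    colour with probability at most [(h / t) ^ h] ([resampling_bound]): the
    colours have to cancel in pairs, there are at most [h ^ h] ways to form the
    pairs, and each pair matches with probability at most [1 / t]. A bad event
    depends on fewer than [h.*2 * Delta] others, so the lopsided local lemma
    ([lopsided_local_lemma]) avoids all of them when
    [e * (h.*2 * Delta) * (h / t) ^ h <= 1] ([odd_hypergraph_colouring]). The
    value of [t] in the theorem is chosen so that this holds whenever there is a
    high vertex ([choice_prob]). *)

(** * Odd colours of a hyperedge *)

Section OddColours.
Variables V K : finType.
Implicit Types (c : {ffun V -> K}) (S : {set V}) (F : {set {set V}}).

(** The set of colours, read as a vector over the two-element field, is the sum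
    of the singletons [c w] for [w] in [S]; so a neighbourhood has an odd colour
    when this vector is nonzero, and an edge is properly coloured when the vector
    of its two ends is nonzero. Both conditions of an odd colouring thus become
    the same condition on a hyperedge. *)
Definition odd_colours c S : {set K} :=
  [set a | odd #|[set w in S | c w == a]|].

Definition recolour c u a : {ffun V -> K} :=
  [ffun x => if x == u then a else c x].

Lemma eq_odd_colours c c' S :
  {in S, c =1 c'} -> odd_colours c S = odd_colours c' S.
Proof.
move=> cc'; apply/setP=> a; rewrite !inE; congr (odd _); apply: eq_card => w.
by rewrite !inE; case: (boolP (w \in S)) => //= /cc' ->.
Qed.

Lemma recolour_same c u a : recolour c u a u = a.
Proof. by rewrite ffunE eqxx. Qed.

Lemma odd_colours_recolour c u a S :
  u \notin S -> odd_colours (recolour c u a) S = odd_colours c S.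
Proof.
move=> uS; apply: eq_odd_colours => w wS; rewrite ffunE.
by case: eqP wS uS => // -> ->.
Qed.

Lemma in_odd_coloursD1 c u S a : u \in S ->
  (a \in odd_colours c S) = (a == c u) (+) (a \in odd_colours c (S :\ u)).
Proof.
move=> uS; rewrite !inE (cardsD1 u) !inE uS /= oddD eq_sym oddb.
congr (_ (+) odd _); apply: eq_card => w; rewrite !inE.
by rewrite andbA.
Qed.

Lemma card_odd_coloursD1 c u S : u \in S ->
  #|odd_colours c S| = if c u \in odd_colours c (S :\ u)
    then #|odd_colours c (S :\ u)|.-1 else #|odd_colours c (S :\ u)|.+1.
Proof.
move=> uS; set D := odd_colours c (S :\ u).
have E a : (a \in odd_colours c S) = (a == c u) (+) (a \in D).
  exact: in_odd_coloursD1.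
case: ifPn => uD.
  rewrite (cardsD1 (c u) D) uD /=; apply: eq_card => a; rewrite E in_setD1.
  by case: eqP => // ->; rewrite uD.
rewrite -(add1n #|D|).
have -> : (1 = (c u \notin D))%N by rewrite (negPf uD).
rewrite -cardsU1; apply: eq_card => a; rewrite E in_setU1.
by case: eqP => // ->; rewrite (negPf uD).
Qed.

(** All requirements that a single vertex has to meet cost it one colour each:
    only the colour that cancels the rest of the hyperedge is excluded. This is
    why a hyperedge is never worse than an ordinary edge. *)
Lemma odd_colours_recolour_eq0 c u a S : u \in S ->
  odd_colours (recolour c u a) S = set0 -> odd_colours c (S :\ u) = [set a].
Proof.
move=> uS S0; apply/setP => b.
have := in_odd_coloursD1 (recolour c u a) b uS.
rewrite S0 in_set0 recolour_same odd_colours_recolour ?setD11 // in_set1.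
by case: (b == a); case: (b \in _).
Qed.

Lemma card_odd_recolour c u F :
  (#|K| - #|[set S in F | u \in S]| <= #|[set a | [forall S in F,
     (u \in S) ==> (odd_colours (recolour c u a) S != set0)]]|)%N.
Proof.
pose A := [set a | [forall S in F,
  (u \in S) ==> (odd_colours (recolour c u a) S != set0)]].
rewrite -/A leq_subLR -(cardsC A) addnC leq_add2r.
rewrite -(card_imset _ set1_inj).
apply: leq_trans (leq_imset_card (fun S => odd_colours c (S :\ u)) _).
apply/subset_leq_card/subsetP => _ /imsetP[a + ->].
rewrite !inE negb_forall_in => /exists_inP[S SF].
rewrite negb_imply negbK => /andP[uS /eqP S0]; apply/imsetP; exists S.
  by rewrite inE SF.
by rewrite (odd_colours_recolour_eq0 uS S0).
Qed.

(** Recolouring a vertex repairs every hyperedge through it and leaves the others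
    alone; a repaired hyperedge can be altered later only through another of its
    vertices, and is then repaired again. *)
Lemma greedy_odd_recolouring F (s : seq V) c :
  {in s, forall u, #|[set S in F | u \in S]| < #|K|}%N ->
  exists c', {in [predC s], c' =1 c} /\
    {in F, forall S, has (mem S) s -> odd_colours c' S != set0}.
Proof.
elim: s => [|u s IHs] Hs; first by exists c; split.
have [|c' [c'c c'F]] := IHs.
  by move=> v vs; apply: Hs; rewrite inE vs orbT.
have : (0 < #|[set a | [forall S in F,
     (u \in S) ==> (odd_colours (recolour c' u a) S != set0)]]|)%N.
  by apply: leq_trans (card_odd_recolour _ _ _); rewrite subn_gt0 Hs ?mem_head.
case/card_gt0P => a; rewrite inE => /forall_inP Ha.
exists (recolour c' u a); split=> [x|S SF].
  rewrite !inE negb_or => /andP[xu xs]; rewrite ffunE (negPf xu).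
  by apply: c'c; rewrite !inE.
rewrite /=; case: (boolP (u \in S)) => [uS _|uS /= sS].
  by have := Ha S SF; rewrite uS.
by rewrite odd_colours_recolour // c'F.
Qed.

End OddColours.

(** * The probability that random colours cancel *)

(** The number [(h.*2)`! / (h`! * 2 ^ h)] of perfect matchings of [h.*2] points
    is a product of the first [h] odd numbers, whose mean is [h]. *)
Lemma odd_factorial_le (h : nat) : ((h.*2)`! <= h ^ h * (h`! * 2 ^ h))%N.
Proof.
have bernoulli n m : (n ^ m.+1 + m.+1 * n ^ m <= n.+1 ^ m.+1)%N.
  elim: m => [|m IHm]; first by rewrite !expn1 expn0; lia.
  rewrite [(n.+1 ^ m.+2)%N]expnS; apply: leq_trans (leq_mul (leqnn _) IHm).
  by rewrite !expnS; nia.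
elim: h => // h IHh; rewrite doubleS !factS.
apply: (@leq_trans ((2 * h.+1) * ((h ^ h.+1 + h.+1 * h ^ h) * (h`! * 2 ^ h))))%N.
  have -> : (h.*2.+2 * (h.*2.+1 * (h.*2)`!) = (2 * h.+1) * (h.*2.+1 * (h.*2)`!))%N.
    by congr muln; lia.
  rewrite leq_mul2l /=.
  have -> : (h ^ h.+1 + h.+1 * h ^ h = h.*2.+1 * h ^ h)%N by rewrite expnS; lia.
  by rewrite -mulnA leq_mul2l IHh.
have -> : (h.+1 ^ h.+1 * (h.+1 * h`! * 2 ^ h.+1) =
   2 * h.+1 * (h.+1 ^ h.+1 * (h`! * 2 ^ h)))%N by rewrite [(2 ^ h.+1)%N]expnS; lia.
by rewrite leq_mul2l leq_mul2r bernoulli orbT.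
Qed.

Section Walk.
Variables (R : realFieldType) (t : nat).

(** Suppose that [n] vertices are coloured one after the other, each uniformly
    from a list of at least [t] colours that may depend on the past. If [j] is
    the number of odd colours before the first step, [cancel_bound n j] bounds
    the probability that no odd colour is left after the last step: the next
    colour is one of the [j] odd ones with probability at most [j / t], and the
    probability of the opposite case is bounded by [1]. *)
Fixpoint cancel_bound n j : R :=
  if n is n'.+1 then j%:R / t%:R * cancel_bound n' j.-1 + cancel_bound n' j.+1
  else (j == 0)%:R.

Lemma cancel_bound_ge0 n j : 0 <= cancel_bound n j.
Proof.
elim: n j => [|n IHn] j /=; first by rewrite ler0n.
by rewrite addr_ge0 // mulr_ge0 // divr_ge0 // ler0n.
Qed.

Lemma cancel_bound_eq0 n j : (n < j)%N || odd (n + j) -> cancel_bound n j = 0.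
Proof.
elim: n j => [|n IHn] [|j] //= nj;
  rewrite ?mulr0n ?mul0r ?add0r !IHn ?mulr0 ?addr0 //; lia.
Qed.

Hypothesis t_gt0 : (0 < t)%N.

(** The coefficient counts the ways in which [j] of the [n] steps cancel the [j]
    given odd colours and the other steps cancel in [i] pairs; every pair and
    every single costs one factor [t]. *)
Lemma cancel_boundE n j i : n = (j + i.*2)%N ->
  cancel_bound n j = (n`!)%:R / ((i`! * 2 ^ i * t ^ (i + j))%N)%:R.
Proof.
have t0 : t%:R != 0 :> R by rewrite pnatr_eq0 -lt0n.
have f0 m : (m`!)%:R != 0 :> R by rewrite pnatr_eq0 -lt0n fact_gt0.
elim: n j i => [|n IHn] [|j] [|i] // nE.
- by rewrite /= divr1.
- rewrite /= mulr0n !mul0r add0r (IHn 1%N i); last by lia.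
  have nE' : n.+1%:R = 2 * i.+1%:R :> R by rewrite -natrM; congr _%:R; lia.
  rewrite addn0 addn1 !factS !expnS !natrM nE' !natrX.
  have i0 : i.+1%:R != 0 :> R by rewrite pnatr_eq0.
  by field; rewrite nat1r i0 f0 t0 !expf_neq0 // pnatr_eq0.
- rewrite /= (cancel_bound_eq0 (j := j.+2)) ?addr0; last by lia.
  rewrite (IHn j 0%N); last by lia.
  have -> : j.+1 = n.+1 by lia.
  have jn : j = n by lia.
  rewrite {}jn !add0n factS expnS fact0 expn0 !mul1n !natrM natrX.
  have n0 : n.+1%:R != 0 :> R by rewrite pnatr_eq0.
  by field; rewrite t0 expf_neq0.
rewrite /= (IHn j i.+1) ?(IHn j.+2 i); [|lia|lia].
have nE' : n.+1%:R = 2 * i.+1%:R + j.+1%:R :> R.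
  by rewrite -natrM -natrD; congr _%:R; lia.
rewrite !addnS !addSn (factS n) (factS i) !expnS !natrM nE' !natrX.
have i0 : i.+1%:R != 0 :> R by rewrite pnatr_eq0.
by field; rewrite nat1r i0 f0 t0 !expf_neq0 // pnatr_eq0.
Qed.

(** Starting from [j = 0] is the worst case: replacing two singles by a pair
    multiplies the bound by at least [t / h.*2], hence [h.*2 <= t] suffices. *)
Lemma cancel_bound_le h j : (h.*2 <= t)%N ->
  cancel_bound h.*2 j <= (h%:R / t%:R) ^+ h.
Proof.
move=> ht.
case: (boolP ((h.*2 < j)%N || odd (h.*2 + j))) => [/cancel_bound_eq0 -> | jh].
  by rewrite exprn_ge0 // divr_ge0.
pose i := (h - j./2)%N.
rewrite (@cancel_boundE _ _ i); last by rewrite /i; lia.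
rewrite expr_div_n ler_pdivrMr; last first.
  by rewrite ltr0n !muln_gt0 fact_gt0 !expn_gt0 t_gt0.
rewrite mulrAC ler_pdivlMr; last by rewrite exprn_gt0 // ltr0n.
rewrite -!natrX -!natrM ler_nat.
have factD m n : ((m + n)`! <= m`! * (m + n) ^ n)%N.
  elim: n => [|n IHn]; first by rewrite addn0 muln1.
  rewrite addnS factS expnS mulnCA leq_mul2l /=.
  apply: leq_trans IHn _; rewrite leq_mul2l; apply/orP; right.
  by case: n => // p; rewrite leq_exp2r.
have -> : (i + j = h + j./2)%N by rewrite /i; lia.
apply: (@leq_trans (h ^ h * (i`! * h ^ j./2 * 2 ^ h) * t ^ h)%N).
  rewrite leq_mul2r; apply/orP; right; apply: leq_trans (odd_factorial_le h) _.
  rewrite leq_mul2l leq_mul2r; apply/orP; right; apply/orP; right.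
  have hE : (h = i + j./2)%N by rewrite /i; lia.
  by rewrite {1 2}hE factD.
have -> : (2 ^ h = 2 ^ i * 2 ^ j./2)%N by rewrite -expnD; congr (2 ^ _)%N; lia.
rewrite -mulnA leq_mul2l; apply/orP; right.
rewrite [(t ^ (_ + _))%N]expnD.
have -> : (i`! * h ^ j./2 * (2 ^ i * 2 ^ j./2) * t ^ h =
  i`! * 2 ^ i * t ^ h * (h * 2) ^ j./2)%N by rewrite expnMn; lia.
rewrite mulnA leq_mul2l muln2; apply/orP; right.
by case: (j./2) => // p; rewrite leq_exp2r.
Qed.
End Walk.

(** Redrawing the colour of one vertex of a uniformly random element of [X],
    among the colours that keep it in [X], gives again a uniformly random element
    of [X]. So the colours of the vertices of a set [M] may be thought of as
    redrawn one after the other, although they depend on each other. In the sums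
    below the set [M] collects the vertices that are still to be redrawn. *)
Section Resampling.
Variables (R : realFieldType) (V K : finType) (t : nat).
Hypothesis t_gt0 : (0 < t)%N.
Variables (X : {set {ffun V -> K}}) (E : {set V}).

(** Summing over [c] in [X] replaces the probabilistic argument: [X] splits into
    lines on which only the colour of [u] varies. On a line the odd colours [D]
    of the other vertices are constant, at most [#|D|] of its colourings cancel a
    colour of [D], and the line has at least [t] elements. *)
Lemma resample_one (M : {set V}) u : u \in E -> u \notin M ->
  (forall c, c \in X -> t <= #|[set a | recolour c u a \in X]|)%N ->
  \sum_(c in X) cancel_bound R t #|M| #|odd_colours c (E :\: M)| <=
  \sum_(c in X) cancel_bound R t #|u |: M| #|odd_colours c (E :\: (u |: M))|.
Proof.
move=> uE uM Xu; have [->|[c0 _]] := set_0Vmem X; first by rewrite !big_set0.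
(* resetting the colour of u identifies the colourings of one line *)
pose key c := recolour c u (c0 u).
have t0 : 0 < t%:R :> R by rewrite ltr0n.
rewrite (partition_big key predT) // [leRHS](partition_big key predT) //=.
apply: ler_sum => b _.
case: (pickP [pred c | (c \in X) && (key c == b)]) => [c1|X0]; last first.
  by rewrite !big_pred0.
move=> /andP[c1X /eqP c1b].
set D := odd_colours c1 (E :\: (u |: M)).
have lineE c : (c \in X) && (key c == b) ->
    c = recolour c1 u (c u) /\ odd_colours c (E :\: (u |: M)) = D.
  move=> /andP[_ /eqP cb]; have cE w : w != u -> c w = c1 w.
    move=> wu; move/ffunP/(_ w): cb; rewrite -c1b !ffunE.
    by rewrite (negPf wu).
  split; first by apply/ffunP => w; rewrite ffunE; case: eqVneq => [->|/cE].
  by apply: eq_odd_colours => w; rewrite !inE negb_or => /andP[/andP[/cE]].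
pose line := [set c | (c \in X) && (key c == b)].
have line_t : (t <= #|line|)%N.
  apply: leq_trans (Xu c1 c1X) _.
  rewrite -(card_imset _ (_ : injective (recolour c1 u))); last first.
    by move=> a a' /ffunP/(_ u); rewrite !recolour_same.
  apply/subset_leq_card/subsetP => _ /imsetP[a + ->]; rewrite !inE => -> /=.
  rewrite -c1b; apply/eqP/ffunP => w; rewrite !ffunE.
  by case: eqP.
have uEM : u \in E :\: M by rewrite inE uM.
have EMu : E :\: (u |: M) = (E :\: M) :\ u by rewrite setDDl setUC.
rewrite [leRHS](eq_bigr (fun=> cancel_bound R t #|u |: M| #|D|)); last first.
  by move=> c /lineE[_ ->].
rewrite cardsU1 uM add1n /=.
set f1 := cancel_bound R t _ #|D|.-1; set f2 := cancel_bound R t _ #|D|.+1.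
have f1_ge0 : 0 <= f1 by apply: cancel_bound_ge0.
have f2_ge0 : 0 <= f2 by apply: cancel_bound_ge0.
apply: (@le_trans _ _ (\sum_(c | (c \in X) && (key c == b))
   ((if c u \in D then f1 else 0) + f2))).
  apply: ler_sum => c /lineE[_ cD].
  rewrite (card_odd_coloursD1 _ uEM) -EMu cD.
  by case: ifP => _; rewrite ?add0r // lerDl.
rewrite !big_split /= lerD2r -big_mkcondr /=.
rewrite !sumr_const -[leLHS]mulr_natl -[leRHS]mulr_natl mulrA ler_wpM2r //.
have -> : #|[pred c | (c \in X) && (key c == b)]| = #|line|.
  by apply: eq_card => c; rewrite !inE.
apply: (@le_trans _ _ #|D|%:R); last first.
  by rewrite mulrCA ler_peMr ?ler0n // ler_pdivlMr // mul1r ler_nat.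
rewrite ler_nat -(card_in_imset (f := fun c : {ffun V -> K} => c u)).
  apply/subset_leq_card/subsetP => _ /imsetP[c + ->].
  by case/andP.
move=> c c' /andP[/lineE[-> _] _] /andP[/lineE[-> _] _].
by rewrite !recolour_same => ->.
Qed.

(** No odd colour on [E] is unlikely as soon as [E] contains [h.*2] vertices that
    can be redrawn, whatever the definition of [X] imposes elsewhere. *)
Lemma resampling_bound h (M : {set V}) :
  M \subset E -> #|M| = h.*2 -> (h.*2 <= t)%N ->
  (forall c u, c \in X -> u \in M ->
     t <= #|[set a | recolour c u a \in X]|)%N ->
  #|X :&: [set c | odd_colours c E == set0]|%:R <=
    (h%:R / t%:R) ^+ h * #|X|%:R :> R.
Proof.
move=> ME Mh ht Xt.
have sample s : uniq s -> {subset s <= M} ->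
    \sum_(c in X) cancel_bound R t 0 #|odd_colours c E| <=
    \sum_(c in X) cancel_bound R t (size s) #|odd_colours c (E :\: [set:: s])|.
  elim: s => [|u s IHs] /=.
    by move=> _ _; rewrite set_nil setD0.
  move=> /andP[us s_uniq] sM.
  apply: le_trans (IHs s_uniq _) _.
    by move=> v vs; apply: sM; rewrite inE vs orbT.
  have sE : #|[set:: s]| = size s by rewrite cardsE (card_uniqP s_uniq).
  have uM : u \in M by apply: sM; rewrite mem_head.
  have us' : u \notin [set:: s] by rewrite inE.
  have := resample_one (subsetP ME u uM) us' (fun c cX => Xt c u cX uM).
  by rewrite cardsU1 us' add1n sE set_cons.
have -> : #|X :&: [set c | odd_colours c E == set0]|%:R =
    \sum_(c in X) cancel_bound R t 0 #|odd_colours c E|.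
  rewrite [RHS](eq_bigr (fun c => if #|odd_colours c E| == 0%N then 1 else 0)).
    rewrite -big_mkcondr -sum1_card natr_sum /=; apply: eq_bigl => c.
    by rewrite inE in_set cards_eq0.
  by move=> c _ /=; case: eqP.
apply: le_trans (sample (enum M) (enum_uniq _) _) _.
  by move=> u; rewrite mem_enum.
rewrite -cardE Mh -sum1_card natr_sum mulr_sumr; apply: ler_sum => c _.
by rewrite mulr1 cancel_bound_le.
Qed.
End Resampling.

(** * The local lemma *)

(** The symmetric lopsided local lemma for the uniform distribution on [Omega],
    stated with cardinals. Lopsided means that [A i] need not be independent of
    the events outside [dep i]; it only has to stay unlikely after conditioning
    on avoiding them. This is all that can be said here, because the colours of a
    uniformly random valid colouring are not independent. *)
Section LocalLemma.
Variables (R : realFieldType) (T I : finType) (Omega : {set T}).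
Variables (A : I -> {set T}) (B : {set I}) (dep : I -> {set I}).
Variables (p x : R) (d : nat).

Definition avoiding (S : {set I}) : {set T} := Omega :\: \bigcup_(i in S) A i.

Hypothesis x01 : 0 <= x < 1.
Hypothesis dep_le : {in B, forall i, #|dep i :\ i| <= d}%N.
Hypothesis p_le : p <= x * (1 - x) ^+ d.
Hypothesis A_le : forall i (S : {set I}), i \in B -> S \subset B ->
  [disjoint S & dep i] ->
  #|avoiding S :&: A i|%:R <= p * #|avoiding S|%:R.

Lemma avoidingS (S S' : {set I}) : S \subset S' -> avoiding S' \subset avoiding S.
Proof.
move=> sSS'; apply: setDS; apply/bigcupsP => i iS.
by apply: bigcup_sup; apply: (subsetP sSS').
Qed.

Lemma avoidingU1 i (S : {set I}) : avoiding (i |: S) = avoiding S :\: A i.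
Proof.
by rewrite /avoiding setDDl bigcup_setU big_set1 setUC.
Qed.

(** Avoiding one more event costs at most a factor [1 - x]. By induction the
    events of [S] that are in [dep i], at most [d] of them, cost at most
    [(1 - x) ^+ d] in total, and the remaining ones leave [A i] with conditional
    probability at most [p]. *)
Lemma avoiding_step n (S : {set I}) i : (#|S| < n)%N -> S \subset B ->
  i \in B -> i \notin S ->
  (1 - x) * #|avoiding S|%:R <= #|avoiding (i |: S)|%:R.
Proof.
have x0 : 0 <= x by case/andP: x01.
have x1 : 0 <= 1 - x by rewrite subr_ge0 ltW //; case/andP: x01.
elim: n S i => // n IHn S i; rewrite ltnS => Sn SB iB iS.
pose S0 := S :\: dep i.
have chain m (S' : {set I}) : S' \subset S -> S0 \subset S' ->
    (#|S' :\: S0| <= m)%N ->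
    (1 - x) ^+ m * #|avoiding S0|%:R <= #|avoiding S'|%:R.
  elim: m S' => [|m IHm] S' S'S S0S'.
    rewrite leqn0 cards_eq0 setD_eq0 => S'S0.
    by rewrite mul1r (_ : S' = S0) //; apply/eqP; rewrite eqEsubset S'S0.
  (* the events of S in dep i are added back to S0 one at a time *)
  move=> S'm; case: (set_0Vmem (S' :\: S0)) => [S'0|[j]].
    apply: le_trans (IHm _ S'S S0S' _); last by rewrite S'0 cards0.
    rewrite ler_wpM2r // exprS ler_piMl ?exprn_ge0 //.
    by rewrite lerBlDr lerDl.
  rewrite inE => /andP[jS0 jS']; rewrite -(setD1K jS') exprS -mulrA.
  have S'jS : S' :\ j \subset S by apply: subset_trans S'S; apply: subsetDl.
  apply: le_trans (IHn (S' :\ j) j _ _ _ _).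
  - rewrite ler_wpM2l // IHm //; first by apply/subsetD1P.
    rewrite setDDl setUC -setDDl -ltnS; apply: leq_trans S'm.
    by rewrite [in X in (_ < X)%N](cardsD1 j) in_setD jS0 jS'.
  - apply: leq_trans Sn; apply: leq_trans (subset_leq_card S'S).
    by rewrite [in X in (_ < X)%N](cardsD1 j) jS'.
  - exact: subset_trans S'jS SB.
  - exact: subsetP SB j (subsetP S'S j jS').
  - by rewrite !inE eqxx.
have S0S : S0 \subset S by apply: subsetDl.
have S0_le : (1 - x) ^+ d * #|avoiding S0|%:R <= #|avoiding S|%:R.
  apply: chain => //; apply: leq_trans (dep_le iB); apply: subset_leq_card.
  apply/subsetP => j; rewrite !inE => /andP[+ jS]; rewrite jS andbT negbK => ->.
  by rewrite andbT; apply: contraNneq iS => <-.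
have bad_le : #|avoiding S :&: A i|%:R <= x * #|avoiding S|%:R.
  apply: (@le_trans _ _ (#|avoiding S0 :&: A i|%:R)).
    by rewrite ler_nat subset_leq_card // setSI // avoidingS.
  apply: le_trans (A_le iB (subset_trans S0S SB) _) _.
    by rewrite disjoint_sym -setI_eq0 /S0 setDE setICA setICr setI0.
  apply: le_trans (ler_wpM2r _ p_le) _; first by [].
  by rewrite -mulrA ler_wpM2l.
rewrite avoidingU1 mulrBl mul1r lerBlDr.
by rewrite -{1}(cardsID (A i) (avoiding S)) natrD addrC lerD2l.
Qed.

Lemma lopsided_local_lemma : Omega != set0 -> avoiding B != set0.
Proof.
have x1 : 0 < 1 - x by rewrite subr_gt0; case/andP: x01.
move=> Omega0; suff H (S : {set I}) : S \subset B -> (0 < #|avoiding S|)%N.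
  by rewrite -card_gt0 H.
elim: {S}#|S| {-2}S (erefl #|S|) => [|n IHn] S Sn SB.
  move/eqP: Sn; rewrite cards_eq0 => /eqP->.
  by rewrite /avoiding big_set0 setD0 card_gt0.
have /card_gt0P[i iS] : (0 < #|S|)%N by rewrite Sn.
rewrite -(ltr0n R) -(setD1K iS).
apply: lt_le_trans (avoiding_step (ltnSn _) _ _ _); rewrite ?setD11 //.
- rewrite mulr_gt0 // ltr0n IHn //.
    by move: Sn; rewrite (cardsD1 i) iS => -[].
  exact: subset_trans (subsetDl _ _) SB.
- exact: subset_trans (subsetDl _ _) SB.
exact: subsetP SB i iS.
Qed.
End LocalLemma.

(** * Colourings of hypergraphs *)

(** The optimal choice [x = 1 / N] in the local lemma turns its condition into
    [e * N * p <= 1]. *)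
Lemma expRN1_le (R : realType) n : expR (- 1) <= (1 - n.+1%:R^-1) ^+ n :> R.
Proof.
case: n => [|n]; first by rewrite expr0 -[leRHS]expR0 ler_expR lerN10.
have inv1D (y : R) : 0 < y -> 1 - (1 + y)^-1 = (1 + y^-1)^-1.
  by move=> y0; field; rewrite !gt_eqF ?addr_gt0 // ltr_pwDl.
rewrite -[n.+2%:R]nat1r inv1D ?ltr0n //.
rewrite exprVn expRN lef_pV2 ?posrE ?expR_gt0 //; last first.
  by rewrite exprn_gt0 // addr_gt0 // invr_gt0 ltr0n.
have -> : expR 1 = expR (n.+1%:R^-1) ^+ n.+1 :> R.
  by rewrite -expRM_natl divff ?pnatr_eq0.
by rewrite lerXn2r ?nnegrE ?expR_ge0 ?expR_ge1Dx // addr_ge0 // invr_ge0.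
Qed.

Lemma card_bigcup_le (I T : finType) (P : {set I}) (G : I -> {set T}) n :
  (forall i, i \in P -> #|G i| <= n)%N ->
  (#|\bigcup_(i in P) G i| <= #|P| * n)%N.
Proof.
move=> Gn; rewrite -sum_nat_const.
apply: (big_rec2 (fun (A : {set T}) m => #|A| <= m)%N); rewrite ?cards0 //.
move=> i m A iP Am; rewrite cardsU; apply: leq_trans (leq_subr _ _) _.
by rewrite leq_add ?Gn.
Qed.

Section OddHypergraphColouring.
Variables (R : realType) (V K : finType) (F B : {set {set V}}).
Variables (D Delta h t : nat).
Hypothesis F_nonempty : set0 \notin F.
Hypothesis F_deg : forall u, (#|[set S in F | u \in S]| <= D)%N.
Hypothesis B_deg : forall u, (#|[set S in B | u \in S]| <= Delta)%N.
Hypothesis B_large : {in B, forall S : {set V}, h.*2 <= #|S|}%N.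
Hypotheses (t_gt0 : (0 < t)%N) (Dt_le : (D + t <= #|K|)%N).
Hypotheses (h_gt0 : (0 < h)%N) (h_le : (h.*2 <= t)%N).
Hypothesis prob_le : B != set0 ->
  expR 1 * (h.*2 * Delta)%:R * (h%:R / t%:R) ^+ h <= 1 :> R.

(** The hyperedges of [F] are built into the probability space, the uniform
    distribution on colourings with an odd colour on each of them; since a vertex
    loses at most one colour to each hyperedge of [F] through it, [t] colours
    remain available at every vertex. The hyperedges of [B] are handled by the
    local lemma. To stop the number of dependencies from growing with the size of
    [S] in [B], only [h.*2] chosen vertices of [S] are redrawn; this event
    interferes with at most [h.*2 * Delta] others. *)
Theorem odd_hypergraph_colouring :
  exists c : {ffun V -> K}, {in F :|: B, forall S, odd_colours c S != set0}.
Proof.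
pose Omega := [set c : {ffun V -> K} | [forall S in F, odd_colours c S != set0]].
have K0 : (0 < #|K|)%N by lia.
have Omega0 : Omega != set0.
  have /card_gt0P[a0 _] := K0.
  case: (@greedy_odd_recolouring V K F (enum V) [ffun=> a0]) => [u _|c [_ cF]].
    by apply: leq_ltn_trans (F_deg u) _; lia.
  apply/set0Pn; exists c; rewrite inE; apply/forall_inP => S SF.
  apply: cF => //; have /set0Pn[u uS] : S != set0.
    by apply: contraNneq F_nonempty => <-.
  by apply/hasP; exists u; rewrite ?mem_enum.
pose A (E : {set V}) := [set c : {ffun V -> K} | odd_colours c E == set0].
pose M (E : {set V}) := [set u in take h.*2 (enum E)].
have ME E : M E \subset E.
  by apply/subsetP => u; rewrite inE => /mem_take; rewrite mem_enum.
have Mh E : E \in B -> #|M E| = h.*2.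
  move=> EB; rewrite cardsE (card_uniqP _) ?take_uniq ?enum_uniq //.
  by rewrite size_takel // -cardE B_large.
pose dep E := [set S in B | ~~ [disjoint S & M E]].
have [B0|[E0 E0B]] := set_0Vmem B.
  case/set0Pn: Omega0 => c; rewrite inE => /forall_inP cF.
  by exists c => S; rewrite B0 setU0 => /cF.
have dep_card E : E \in B -> (#|dep E :\ E| < h.*2 * Delta)%N.
  move=> EB; have EE : E \in dep E.
    rewrite inE EB /= -setI_eq0 setIC (setIidPl (ME E)) -card_gt0 Mh //.
    by rewrite double_gt0.
  have := cardsD1 E (dep E); rewrite EE add1n => <-; rewrite -(Mh E EB).
  apply: leq_trans (card_bigcup_le (fun u _ => B_deg u)).
  apply/subset_leq_card/subsetP => S; rewrite inE => /andP[SB].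
  case/pred0Pn => u /andP[uS uM]; apply/bigcupP; exists u => //.
  by rewrite inE SB.
have prob_le' : expR 1 * (h.*2 * Delta)%:R * (h%:R / t%:R) ^+ h <= 1 :> R.
  by apply: prob_le; apply/set0Pn; exists E0.
set N := (h.*2 * Delta)%N in dep_card prob_le'.
have N0 : (0 < N)%N by apply: leq_ltn_trans (dep_card E0 E0B).
have NR0 : 0 < N%:R :> R by rewrite ltr0n.
have N1E : N = N.-1.+1 by rewrite prednK.
have : avoiding Omega A B != set0.
  apply: (@lopsided_local_lemma R _ _ Omega A B dep
    ((h%:R / t%:R) ^+ h) N%:R^-1 N.-1) => //.
  - rewrite invr_ge0 ler0n invf_lt1 // ltr1n /N -doubleMl.
    by move: N0; rewrite /N -doubleMl; lia.
  - by move=> E EB; have := dep_card E EB; rewrite {1}N1E ltnS.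
  - have := expRN1_le R N.-1; rewrite -N1E => eN.
    rewrite -ler_pdivrMl ?invr_gt0 // invrK; apply: le_trans eN.
    rewrite expRN -[leRHS]mulr1 ler_pdivlMl ?expR_gt0 // mulrA.
    exact: prob_le'.
  move=> E S EB SB SE.
  have Xin c : (c \in avoiding Omega A S) =
      [forall T in F, odd_colours c T != set0] &&
      [forall T in S, odd_colours c T != set0].
    rewrite !inE andbC; congr (_ && _); apply/idP/forall_inP.
      move=> H T TS; apply: contraNneq H => T0; apply/bigcupP; exists T => //.
      by rewrite inE T0.
    by move=> H; apply/bigcupP => -[T /H]; rewrite inE => /negPf->.
  apply: (resampling_bound R t_gt0 (ME E)); rewrite ?Mh // => c u.
  move=> Xc uM.
  have Dt : (t <= #|K| - #|[set S in F | u \in S]|)%N.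
    by apply: leq_trans (leq_sub2l _ (F_deg u)); move: Dt_le; clear; lia.
  apply: leq_trans Dt _; apply: leq_trans (card_odd_recolour c u F) _.
  apply/subset_leq_card/subsetP => a; rewrite in_set => /forall_inP aF.
  rewrite in_set Xin.
  move: (Xin c) Xc => -> /andP[/forall_inP cF /forall_inP cS].
  apply/andP; split; apply/forall_inP => T TF.
    have [uT|uT] := boolP (u \in T); first by have := aF T TF; rewrite uT.
    by rewrite odd_colours_recolour // cF.
  rewrite odd_colours_recolour ?cS //; apply/negP => uT.
  have : T \in dep E.
    by rewrite inE (subsetP SB) //=; apply/pred0Pn; exists u; rewrite /= uT.
  by rewrite (disjointFr SE TF).
case/set0Pn => c; rewrite !inE => /andP[cB /forall_inP cF].
exists c => S; rewrite inE => /orP[/cF //|SB].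
by apply: contraNneq cB => S0; apply/bigcupP; exists S; rewrite // inE S0.
Qed.
End OddHypergraphColouring.

(** * Odd colourings of graphs *)

Lemma odd_colours_pair (V K : finType) (c : {ffun V -> K}) u v :
  u != v -> odd_colours c [set u; v] != set0 -> c u != c v.
Proof.
move=> uv; apply: contraNneq => cuv; apply/eqP/setP => a; rewrite in_set0.
rewrite (in_odd_coloursD1 _ _ (set21 u v)) setU1K ?in_set1 //.
rewrite (in_odd_coloursD1 _ _ (set11 v)) cuv setDv addbA addbb /=.
rewrite in_set (_ : [set _ in set0 | _] = set0) ?cards0 //.
by apply/setP => w; rewrite !inE.
Qed.

Section Graph.
Variables (R : realType) (G : sgraph) (Delta h t : nat).
Hypothesis G_deg : forall v : G, (#|neighbours v| <= Delta)%N.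
Hypotheses (h_gt0 : (0 < h)%N) (h_le : (h.*2 <= t)%N).
Hypothesis low_lt : (h.*2.-1.*2 < Delta + t)%N.
Hypothesis prob_le : (h.*2 <= Delta)%N ->
  expR 1 * (h.*2 * Delta)%:R * (h%:R / t%:R) ^+ h <= 1 :> R.

(** The vertices are divided by degree. A low vertex sees few neighbours, so it
    can satisfy all conditions around it even when it is coloured last; a high
    vertex has a neighbourhood that is large enough for the local lemma. *)
Let H : {set G} := [set v | h.*2 <= #|neighbours v|]%N.

Lemma odd_colouring_of_hyperedges k (c : {ffun G -> 'I_k}) :
  (forall u v : G, edge u v -> odd_colours c [set u; v] != set0) ->
  (forall v : G, neighbours v != set0 -> odd_colours c (neighbours v) != set0) ->
  odd_colouring c.
Proof.
move=> c_edge c_nbr; apply/andP; split.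
  apply/forallP => u; apply/forallP => v; apply/implyP => uv.
  apply: odd_colours_pair (c_edge _ _ uv).
  by apply: contraTneq uv => ->; rewrite edge_irrefl.
apply/forallP => v; apply/implyP => /c_nbr/set0Pn[a]; rewrite in_set => va.
by apply/existsP; exists a.
Qed.

(** The hyperedges inside [H] that are imposed from the start. A neighbour [x] of
    [u] contributes either the edge [[set u; x]], if [x] is high, or its own
    neighbourhood, if [x] is low, but never both; hence no vertex is in more than
    [Delta] of them. *)
Let F : {set {set G}} :=
  [set S | [exists u in H, exists v in H, edge u v && (S == [set u; v])]] :|:
  [set S | [exists x in ~: H, [&& S == neighbours x, S != set0 & S \subset H]]].
Let B : {set {set G}} :=
  [set S | [exists x in H, (S == neighbours x) && (S \subset H)]].
(** The hyperedges that contain a low vertex, which are left to the greedy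
    recolouring of the low vertices. *)
Let F' : {set {set G}} :=
  [set S : {set G} | ~~ (S \subset H) &&
   ([exists u, exists v, edge u v && (S == [set u; v])] ||
    [exists x : G, S == neighbours x])].

Lemma in_neighbours (u v : G) : (u \in neighbours v) = edge v u.
Proof. by rewrite inE. Qed.

Lemma F_deg u : (#|[set S in F | u \in S]| <= Delta)%N.
Proof.
pose f x := if x \in H then [set u; x] else neighbours x.
apply: leq_trans (G_deg u); apply: leq_trans (leq_imset_card f _).
apply/subset_leq_card/subsetP => S; rewrite inE => /andP[+ uS].
rewrite in_setU !in_set => /orP[|] /exists_inP[x xH].
  case/exists_inP=> y yH /andP[xy /eqP SE]; apply/imsetP.
  move: uS xy; rewrite SE in_set2 => /orP[] /eqP <- uy.
    by exists y; rewrite ?in_neighbours // /f yH.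
  by exists x; rewrite ?in_neighbours 1?edge_sym // /f xH setUC.
rewrite inE in xH; case/and3P=> /eqP SE _ _; apply/imsetP; exists x.
  by move: uS; rewrite SE !in_neighbours edge_sym.
by rewrite /f (negPf xH).
Qed.

Lemma B_deg u : (#|[set S in B | u \in S]| <= Delta)%N.
Proof.
apply: leq_trans (G_deg u); apply: leq_trans (leq_imset_card (@neighbours G) _).
apply/subset_leq_card/subsetP => S; rewrite !inE => /andP[+ uS].
case/exists_inP=> x _ /andP[/eqP SE _]; apply/imsetP; exists x => //.
by move: uS; rewrite SE !in_neighbours edge_sym.
Qed.

(** Here a neighbour may contribute both an edge and its neighbourhood, which a
    low vertex can afford. *)
Lemma F'_deg u : u \notin H -> (#|[set S in F' | u \in S]| < Delta + t)%N.
Proof.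
rewrite inE -ltnNge => uH; apply: leq_ltn_trans low_lt.
apply: (@leq_trans (#|(fun x => [set u; x]) @: neighbours u| +
                    #|@neighbours G @: neighbours u|)); last first.
  rewrite -addnn leq_add // (leq_trans (leq_imset_card _ _)) //; lia.
apply: leq_trans (leq_card_setU _ _).
apply/subset_leq_card/subsetP => S; rewrite inE => /andP[+ uS].
rewrite inE => /andP[_ /orP[|]]; last first.
  case/existsP=> x /eqP SE; rewrite inE; apply/orP; right; apply/imsetP.
  by exists x => //; move: uS; rewrite SE !in_neighbours edge_sym.
case/existsP=> x /existsP[y /andP[xy /eqP SE]]; rewrite inE.
apply/orP; left; apply/imsetP.
move: uS xy; rewrite SE in_set2 => /orP[] /eqP <- uy.
  by exists y; rewrite ?in_neighbours.
by exists x; rewrite ?in_neighbours 1?edge_sym // setUC.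
Qed.

Lemma odd_colourable_of_prob : odd_colourable G (Delta + t).
Proof.
have [|||||||||c0 c0F] := @odd_hypergraph_colouring R G 'I_(Delta + t) F B
  Delta Delta h t.
- apply/negP; rewrite in_setU !in_set => /orP[] /exists_inP[x _].
    case/exists_inP=> y _ /andP[_ /eqP/setP/(_ x)].
    by rewrite !inE eqxx.
  by rewrite eqxx andbF.
- exact: F_deg.
- exact: B_deg.
- move=> S; rewrite inE => /exists_inP[x xH /andP[/eqP-> _]].
  by rewrite inE in xH.
- by apply: leq_trans h_le; rewrite double_gt0.
- by rewrite card_ord.
- exact: h_gt0.
- exact: h_le.
- case/set0Pn=> S; rewrite inE => /exists_inP[x]; rewrite inE => xH _.
  by apply: prob_le; apply: leq_trans xH (G_deg x).
have [u|c [cc0 cF']] := @greedy_odd_recolouring G _ F' (enum (~: H)) c0.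
  by rewrite mem_enum inE card_ord; apply: F'_deg.
(* hyperedges inside H keep their colours from c0 *)
have good S : (S \in F :|: B) && (S \subset H) || (S \in F') ->
    odd_colours c S != set0.
  case/orP=> [/andP[/c0F + SH]|SF']; last first.
    apply: cF' => //; move: SF'; rewrite inE => /andP[/subsetPn[u uS uH] _].
    by apply/hasP; exists u; rewrite // mem_enum inE.
  rewrite (eq_odd_colours (c' := c)) // => u uS; rewrite cc0 //.
  by rewrite !inE mem_enum inE negbK (subsetP SH).
apply/existsP; exists c; apply: odd_colouring_of_hyperedges => [u v uv|v v0].
  apply: good; rewrite in_setU !in_set.
  have [uvH|uvH] := boolP ([set u; v] \subset H).
    have [uH vH] : u \in H /\ v \in H.
      by split; apply: (subsetP uvH); rewrite ?set21 ?set22.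
    rewrite andbT; apply/orP; left; apply/orP; left; apply/orP; left.
    apply/exists_inP; exists u => //; apply/exists_inP; exists v => //.
    by rewrite uv eqxx.
  rewrite andbF /=; apply/orP; left; apply/existsP; exists u.
  by apply/existsP; exists v; rewrite uv eqxx.
apply: good; rewrite in_setU !in_set.
have [vH|vH] := boolP (neighbours v \subset H); last first.
  by rewrite andbF /=; apply/orP; right; apply/existsP; exists v.
rewrite andbT; apply/orP; left.
have [vh|vh] := boolP (v \in H); apply/orP; [right | left; apply/orP; right];
  apply/exists_inP; exists v; rewrite ?eqxx //.
  by rewrite in_setC.
by rewrite v0.
Qed.
End Graph.

(** * Choice of the parameters *)

Section Numeric.
Variable R : realType.

(** Obtained from the values of [(1 + 1 / n) ^ n] and [(1 - 1 / n) ^ (- n)] at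
    [n = 32]; the lower bound is chosen to give [7 <= e ^ 2]. *)
Lemma expR1_bounds : 53/20 <= expR (1:R) <= 3.
Proof.
have e32 : expR 1 = expR (32%:R^-1) ^+ 32 :> R.
  by rewrite -expRM_natl divff // pnatr_eq0.
apply/andP; split.
  apply: (@le_trans _ _ ((1 + 32%:R^-1) ^+ 32)); first by lra.
  by rewrite e32 lerXn2r ?nnegrE ?expR_ge0 ?expR_ge1Dx //; lra.
apply: (@le_trans _ _ ((32/31) ^+ 32)); last by lra.
rewrite e32 lerXn2r ?nnegrE ?expR_ge0 //; first by lra.
have -> : 32/31 = (1 + - 32%:R^-1)^-1 :> R by field.
rewrite -[leLHS]invrK -expRN lef_pV2 ?posrE ?expR_gt0 ?expR_ge1Dx //; lra.
Qed.

Lemma ln2_ge : 1/2 <= ln (2:R).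
Proof.
have : ln (1 + - (1/2) : R) <= - (1/2) by apply: le_ln1Dx; lra.
have -> : 1 + - (1/2) = 2^-1 :> R by lra.
by rewrite lnV ?posrE //; lra.
Qed.

Lemma natr_ceil (x : R) : 0 <= x ->
  x <= `|Num.ceil x|%N%:R /\ `|Num.ceil x|%N%:R < x + 1.
Proof.
move=> x0; have /andP[lo hi] := ceil_itv x.
have -> : `|Num.ceil x|%N%:R = (Num.ceil x)%:~R :> R.
  by rewrite natr_absz ger0_norm // ceil_ge0; lra.
by split=> //; move: lo; rewrite rmorphB /=; lra.
Qed.

Lemma ln_le_sub1 (x : R) : 0 < x -> ln x <= x - 1.
Proof.
move=> x0; have {1}-> : x = 1 + (x - 1) by lra.
by apply: le_ln1Dx; lra.
Qed.

(** The parameters. With [Y = ln (Delta * ln Delta * e ^ 3)], there are [t] colours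
    more than [Delta], and [h] is about [t / 4]: a low vertex of degree less than
    [h.*2] then faces fewer than [t + 2] requirements, and a high neighbourhood
    fails with probability at most [3 ^ - h], which is at most [expR (- Y)]. *)
Section Choice.
Variable Delta : nat.
Let L : R := ln Delta%:R.
Let Y := L + ln L + 3.
Let h := `|Num.ceil Y|%N.
Let t := `|Num.ceil (4 * Y)|%N.
Hypothesis Delta_ge2 : (2 <= Delta)%N.

Lemma ln_ge_half : 1/2 <= L.
Proof.
by apply: le_trans ln2_ge _; rewrite ler_ln ?posrE ?ltr0n ?ler_nat //; lia.
Qed.

Lemma log_scale_ge3 : 3 <= Y.
Proof.
have L0 : 0 < L by have := ln_ge_half; lra.
have D2 : 2 <= Delta%:R :> R by rewrite ler_nat.
have := @ln_ge0 R (Delta%:R * L); rewrite lnM ?posrE //; last by lra.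
rewrite -/L /Y => H; suff: 0 <= L + ln L by lra.
by apply: H; have := ln_ge_half; nra.
Qed.

Lemma choice_bounds : [/\ 3 <= h, h * 3 <= t & h * 4 <= t + 3]%N.
Proof.
have Y3 := log_scale_ge3.
have [|hY hY1] := @natr_ceil Y; first by lra.
have [|tY _] := @natr_ceil (4 * Y); first by lra.
have h3 : (3 <= h)%N by rewrite -(ler_nat R); apply: le_trans hY.
have ht : (h * 4 < t + 4)%N.
  by rewrite -(ltr_nat R) natrD natrM -/h -/t in hY1 tY *; lra.
by split=> //; move: ht h3; clear; lia.
Qed.

(** [expR (- Y)] is [1 / (Delta * ln Delta * e ^ 3)], so the claim reduces to
    [2 * h <= e ^ 2 * ln Delta], where [h] exceeds [Y] by less than one. For large
    [Delta] this is clear because [ln (ln Delta) <= ln Delta - 1]; it holds once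
    [2 <= ln Delta]. A high vertex forces [Delta] to be that large: the bounds on
    [Delta], [ln Delta] and [h] improve each other. *)
Lemma choice_prob : (h.*2 <= Delta)%N ->
  expR 1 * (h.*2 * Delta)%:R * (h%:R / t%:R) ^+ h <= 1 :> R.
Proof.
move=> hD; have D_gt0 : (0 < Delta)%N by apply: ltnW.
have [h3 ht _] := choice_bounds.
have Y3 := log_scale_ge3.
have [|hY hY1] := @natr_ceil Y; first by lra.
have lnD n : (0 < n <= Delta)%N -> ln n%:R <= L.
  by move=> /andP[n0 nD]; rewrite ler_ln ?posrE ?ltr0n ?ler_nat //; lia.
have ln2 := ln2_ge.
have ln4 : ln 4%:R = 2 * ln 2 :> R.
  by rewrite -[4%N]/(2 ^ 2)%N natrX lnXn // mulr2n; lra.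
have ln8 : ln 8%:R = 3 * ln 2 :> R.
  by rewrite -[8%N]/(2 ^ 3)%N natrX lnXn // !mulrS mulr0n; lra.
(* h.*2 <= Delta gives 4 <= Delta, then 8 <= Delta, then 9 <= Delta, as h grows *)
have L1 : 1 <= L by have := lnD 4%N; rewrite ln4 => H; have := H ltac:(lia); lra.
have h4 : (4 <= h)%N.
  by rewrite -(ler_nat R); have := ln_ge0 L1; move: hY; rewrite -/h /Y; lra.
have L15 : 3/2 <= L by have := lnD 8%N; rewrite ln8 => H; have := H ltac:(lia); lra.
have h5 : (5 <= h)%N.
  rewrite -(ltr_nat R); have := ln_ge0 L1; move: hY; rewrite -/h /Y; lra.
have /andP[e_ge e_le] := expR1_bounds.
have L2 : 2 <= L.
  have D9 : 9%:R <= Delta%:R :> R by rewrite ler_nat; move: h5 hD; clear; lia.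
  rewrite -[2]expRK ler_ln ?posrE ?expR_gt0 ?ltr0n //.
  apply: le_trans D9; rewrite -[2]mulr1 expRM_natl.
  have := expR_gt0 (1:R); nra.
have h_le_L : 2 * h%:R <= expR 1 ^+ 2 * L.
  apply: (@le_trans _ _ (7 * L)).
    by have := @ln_le_sub1 L; move: hY1; rewrite -/h /Y; lra.
  by rewrite ler_wpM2r //; [lra | rewrite expr2; nra].
have expRY : expR Y = Delta%:R * L * expR 1 ^+ 3.
  rewrite -expRM_natl mulr1 /Y 2!expRD lnK ?posrE; last by lra.
  by rewrite /L lnK ?posrE ?ltr0n.
have D0 : 0 < Delta%:R :> R by rewrite ltr0n.
have p_le : (h%:R / t%:R) ^+ h <= (expR Y)^-1 :> R.
  apply: (@le_trans _ _ ((expR (- 1)) ^+ h)).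
    rewrite lerXn2r ?nnegrE ?expR_ge0 ?divr_ge0 ?ler0n //.
    have t0 : 0 < t%:R :> R by rewrite ltr0n; move: ht h3; clear; lia.
    rewrite ler_pdivrMr // expRN ler_pdivlMl ?expR_gt0 //.
    apply: (@le_trans _ _ (h * 3)%:R); last by rewrite ler_nat.
    by rewrite natrM mulrC ler_wpM2l ?ler0n.
  by rewrite -expRM_natl mulrN1 expRN lef_pV2 ?posrE ?expR_gt0 // ler_expR.
apply: le_trans (ler_wpM2l _ p_le) _; first by rewrite mulr_ge0 ?expR_ge0 ?ler0n.
rewrite ler_pdivrMr ?expR_gt0 // mul1r expRY natrM -muln2 natrM.
have -> : expR 1 * (h%:R * 2 * Delta%:R) = (2 * h%:R) * (Delta%:R * expR 1) :> R.
  by ring.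
have -> : Delta%:R * L * expR 1 ^+ 3 = (expR 1 ^+ 2 * L) * (Delta%:R * expR 1).
  by ring.
by rewrite ler_wpM2r // mulr_ge0 ?expR_ge0 // ltW.
Qed.
End Choice.
End Numeric.

Theorem theorem1p3 (R : realType) (G : sgraph) (Delta : nat)
    (hDelta : max_degree G = Delta) (Delta_ge2 : (2 <= Delta)%N) :
  (odd_chromatic_number G)%:Z <=
    Delta%:Z + Num.ceil (4 * (ln (Delta%:R : R) + ln (ln (Delta%:R : R)) + 3)).
Proof.
have Y3 := log_scale_ge3 R Delta_ge2.
rewrite -[Num.ceil _]ger0_norm; last by rewrite ceil_ge0; lra.
rewrite -abszE -PoszD lez_nat /odd_chromatic_number.
case: ex_minnP => n _; apply.
have [h3 h3t h4t] := choice_bounds R Delta_ge2.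
apply: (@odd_colourable_of_prob R G Delta
  `|Num.ceil (ln (Delta%:R : R) + ln (ln (Delta%:R : R)) + 3)|%N).
- by move=> v; rewrite -hDelta; apply: leq_bigmax.
- exact: leq_trans h3.
- by move: h3t; clear; lia.
- by move: h3 h4t Delta_ge2; clear; lia.
exact: choice_prob.
Qed.
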